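(* A chain mixed graph (CMG) $G=(V,E)$ is maximal if and only if every missing edge in $G$ corresponds to a pairwise conditional independence statement in $\mathcal{J}(G)$, i.e. for every pair of distinct non-adjacent nodes $i,j\in V$ there is a set $C\subseteq V\setminus\{i,j\}$ with $\langle \{i\},\{j\}\,|\,C\rangle\in\mathcal{J}(G)$.
   Context: Graphs: a graph $G=(V,E)$ has a finite node set $V$ and edges of four possible types: lines (solid, undirected), arrows ($i\to j$), arcs ($i\leftrightarrow j$), and dotted lines (undirected). There are no loops, but multiple edges between the same two nodes are allowed. Two nodes are adjacent if they are the endpoints of some edge. A walk is a list $\langle i_0,e_1,i_1,\dots,e_n,i_n\rangle$ of nodes and edges with $e_m$ having endpoints $i_{m-1},i_m$; nodes and edges may repeat. Sections and separation: a section of a walk is a maximal subwalk consisting only of solid lines (possibly a single node); a walk decomposes uniquely into sections. A section is an endpoint section if it contains an endpoint (first or last position) of the walk, otherwise an inner section. An inner section is a collider section if, of the two edges of the walk adjacent to it, both have an arrowhead pointing to the section, or one has an arrowhead pointing to the section and the other is a dotted line. All other sections, including endpoint sections, are non-collider sections. A walk is connecting given $C$ if all its collider sections intersect $C$ and all its non-collider sections are disjoint from $C$. For pairwise disjoint $A,B,C\subseteq V$, $A\perp B\,|\,C$ means there is no connecting walk given $C$ between a node of $A$ and a node of $B$. The independence model induced by $G$ is $\mathcal{J}(G)=\{\langle A,B\,|\,C\rangle : A\perp B\,|\,C\}$. CMGs: a walk from $i$ to $j$ is semi-directed if it has at least one arrow, no arcs, and every arrow on it points in the direction from $i$ to $j$.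 A CMG is a graph without dotted lines and without semi-directed cycles (a cycle is a closed walk with at least two edges and no repeated node except its coinciding first and last nodes). Maximality: $G$ is maximal if adding an edge between any two non-adjacent nodes of $G$ changes the independence model $\mathcal{J}(G)$. *)

(* Defs.v *)
From mathcomp Require Import all_boot.

Set Implicit Arguments.
Unset Strict Implicit.
Unset Printing Implicit Defensive.

Variant edge_kind := Line | Arrow | Arc | Dotted.

Definition is_line k := if k is Line then true else false.
Definition is_arrow k := if k is Arrow then true else false.
Definition is_arc k := if k is Arc then true else false.
Definition is_dotted k := if k is Dotted then true else false.

(* Edges form a type of their own, so that multiple edges between the same two
   nodes are possible.  An arrow points from [src] to [tgt]; for the other kinds
   the order of the two endpoints is immaterial. *)
Record mgraph (V E : finType) := MGraph {
  kind : E -> edge_kind;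
  src : E -> V;
  tgt : E -> V;
  loopless : forall e, src e != tgt e
}.

Section Graph.
Variables (V E : finType) (G : mgraph V E).
Implicit Types (e f : E) (i j x y : V) (p s q w : seq (E * V)) (A B C : {set V}).

Definition joins e i j :=
  ((src G e == i) && (tgt G e == j)) || ((src G e == j) && (tgt G e == i)).

Definition adjacent i j := [exists e, joins e i j].

(* The walk <i0, e1, i1, ..., en, in> is represented by its first node i0 and
   the sequence w = [:: (e1, i1); ...; (en, in)]. *)
Fixpoint is_walk i w :=
  if w is (e, j) :: w' then joins e i j && is_walk j w' else true.

Definition walk_end i w := last i (unzip2 w).

(* Does e have an arrowhead at its endpoint x? *)
Definition arrowhead_at e x :=
  match kind G e with
  | Arrow => tgt G e == x
  | Arc => (src G e == x) || (tgt G e == x)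
  | _ => false
  end.

(* The sections of the walk (i, w) are the splittings w = p ++ s ++ q satisfying
   [is_section p s q]; the section starts at the node [walk_end i p] and follows
   the steps s.  The edges of the walk adjacent to it are the last edge of p and
   the first edge of q; it is an endpoint section when p or q is empty. *)
Definition edge_before p : option E := ohead (rev (unzip1 p)).
Definition edge_after q : option E := ohead (unzip1 q).

Definition all_lines s := all (fun u => is_line (kind G u.1)) s.

Definition not_line (oe : option E) :=
  if oe is Some e then ~~ is_line (kind G e) else true.

Definition is_section p s q :=
  [&& all_lines s, not_line (edge_before p) & not_line (edge_after q)].

Definition section_nodes i p s := walk_end i p :: unzip2 s.

(* Arrowheads are tested at the positions where the adjacent edges enter and
   leave the section, namely at its first and its last node. *)
Definition collider_section i p s q :=
  if (edge_before p, edge_after q) is (Some e, Some f) then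
    let x := walk_end i p in
    let y := walk_end x s in
    [|| arrowhead_at e x && arrowhead_at f y,
        arrowhead_at e x && is_dotted (kind G f)
      | is_dotted (kind G e) && arrowhead_at f y]
  else false.

Definition connecting C i w :=
  forall p s q, w = p ++ s ++ q -> is_section p s q ->
    if collider_section i p s q
    then exists2 x, x \in section_nodes i p s & x \in C
    else forall x, x \in section_nodes i p s -> x \notin C.

Definition separated A B C :=
  forall i w, i \in A -> walk_end i w \in B -> is_walk i w ->
    ~ connecting C i w.

Definition indep_model A B C :=
  [/\ [disjoint A & B], [disjoint A & C], [disjoint B & C] & separated A B C].

Definition semi_directed w :=
  [&& has (fun u => is_arrow (kind G u.1)) w,
      all (fun u => ~~ is_arc (kind G u.1)) w
    & all (fun u => is_arrow (kind G u.1) ==> (tgt G u.1 == u.2)) w].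

Definition is_cycle i w :=
  [&& is_walk i w, walk_end i w == i, 2 <= size w & uniq (unzip2 w)].

Definition is_CMG :=
  (forall e, ~~ is_dotted (kind G e)) /\
  (forall i w, is_cycle i w -> ~~ semi_directed w).

End Graph.

Section AddEdge.
Variables (V E : finType) (G : mgraph V E) (k : edge_kind) (i j : V).
Hypothesis ij : i != j.

Definition add_kind (oe : option E) := if oe is Some e then kind G e else k.
Definition add_src (oe : option E) := if oe is Some e then src G e else i.
Definition add_tgt (oe : option E) := if oe is Some e then tgt G e else j.

Lemma add_loopless oe : add_src oe != add_tgt oe.
Proof. by case: oe => [e|] //=; apply: loopless. Qed.

(* G with one new edge, of kind k and with source i and target j. *)
Definition add_edge : mgraph V (option E) :=
  @MGraph V (option E) add_kind add_src add_tgt add_loopless.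

End AddEdge.

Definition same_model (V E E' : finType) (G : mgraph V E) (H : mgraph V E') :=
  forall A B C : {set V}, indep_model G A B C <-> indep_model H A B C.

(* The added edge may be of any of the four kinds; both orientations of an
   arrow are covered since (i, j) ranges over ordered pairs. *)
Definition maximal (V E : finType) (G : mgraph V E) :=
  forall (k : edge_kind) (i j : V) (ij : i != j), ~~ adjacent G i j ->
    ~ same_model G (add_edge G k ij).

(* Main.v *)
Require Import Defs.
From mathcomp Require Import all_boot.

Set Implicit Arguments.
Unset Strict Implicit.
Unset Printing Implicit Defensive.

(* Suppose no C separates the non-adjacent nodes i, j.  Every node of a walk
   connecting given C is anterior to C or to an endpoint, so a walk connecting
   given C = ant {i, j} minus {i, j} has non-collider sections inside {i, j};
   between consecutive such sections i and j it is an inducing walk: all inner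
   sections are colliders in ant {i, j}.  Acyclicity forbids both outer edges
   from being arrows out of i and j, and adding the edge with the same
   arrowheads at i and j as the inducing walk (an arrow or an arc) does not
   change the model: replace the new edge by the inducing walk, which leaves
   collider sections in ant (C, a, b), and repair those outside ant C by
   restarting at a or stopping at b, the others by a detour to C.  Conversely
   the new edge is itself a connecting walk given a separating set. *)

(** * Abstract walks, anterior sets and the repair of collider sections *)

(* [ln x y]: there is a line between x and y.  [nl hx hy x y]: there is another
   edge between x and y, with an arrowhead at x iff hx and at y iff hy. *)
Section Separation.
Variables (V : finType) (ln : rel V) (nl : bool -> bool -> rel V).
Hypothesis lnC : symmetric ln.
Hypothesis nlC : forall hx hy x y, nl hx hy x y = nl hy hx y x.
Hypothesis nlFF : forall x y, nl false false x y = false.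

(* In [opn Q C b x h m] a walk is at x, inside a section that was entered with
   an arrowhead iff h and that has met C iff m; it can be continued to b so that
   non-collider sections avoid C, and a collider section left at x, having met
   C iff m, satisfies [Q x m]. *)
Inductive opn (Q : V -> bool -> bool) (C : {set V}) (b : V) :
    V -> bool -> bool -> Prop :=
| opn_end h : opn Q C b b h false
| opn_line x y h m :
    ln x y -> opn Q C b y h (m || (y \in C)) -> opn Q C b x h m
| opn_edge x y hx hy h m :
    nl hx hy x y -> (if h && hx then Q x m else ~~ m) ->
    opn Q C b y hy (y \in C) -> opn Q C b x h m.

Definition opn_met := opn (fun _ m => m).
Definition opn_in (S : {set V}) := opn (fun x _ => x \in S).

(** A step along a line or along an arrow in its direction, so that [ant D] below is the anterior
    set of D, with D included. *)
Definition toward x y := ln x y || nl false true x y.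
Definition ant (D : {set V}) := [set x | [exists d in D, connect toward x d]].

Lemma antP (D : {set V}) x : reflect (exists2 d, d \in D & connect toward x d) (x \in ant D).
Proof. by rewrite inE; apply: (iffP exists_inP). Qed.

Lemma sub_ant (D : {set V}) : {subset D <= ant D}.
Proof. by move=> x xD; apply/antP; exists x. Qed.

Lemma ant_connect (D : {set V}) x y : connect toward x y -> y \in ant D -> x \in ant D.
Proof.
move=> xy /antP[d dD yd]; apply/antP; exists d => //.
exact: connect_trans xy yd.
Qed.

Lemma ant_step D x y : toward x y -> y \in ant D -> x \in ant D.
Proof. by move=> xy; apply/ant_connect/connect1. Qed.

Lemma ant_line D x y : ln x y -> x \in ant D -> y \in ant D.
Proof. by move=> xy; apply: ant_step; rewrite /toward lnC xy. Qed.

Lemma ant_sub (D D' : {set V}) : {subset D <= ant D'} -> {subset ant D <= ant D'}.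
Proof. by move=> DD' x /antP[d /DD' dD xd]; apply: ant_connect dD. Qed.

Lemma toward_ind (P : V -> Prop) d :
  P d -> (forall x y, toward x y -> P y -> P x) ->
  forall x, connect toward x d -> P x.
Proof.
move=> Pd PS x /connectP[p]; elim: p x => [|y p IH] x /=; first by move=> _ <-.
by move=> /andP[xy yp] dE; apply: PS xy _; apply: IH.
Qed.

(* The walk from d back to x avoids C and enters x with a tail, so that x becomes
   part of a non-collider section. *)
Lemma opn_restart S C b d x :
  x \notin ant C -> connect toward x d ->
  opn_in S C b x false false -> opn_in S C b d false false.
Proof.
move=> xC xd; move: x xd xC; apply: toward_ind => // x y xy IH xC ox.
have yC : y \notin ant C by apply: contra xC; apply: ant_step.
have {}xC : (x \in C) = false by apply: contraNF xC; apply: sub_ant.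
apply: IH => //; case/orP: xy => xy.
  by apply: (@opn_line _ _ _ y x); rewrite ?xC // lnC.
by apply: (@opn_edge _ _ _ y x true false); rewrite ?xC // nlC.
Qed.

(** Cut at the last collider section that is not anterior to C or b. It is anterior to a, and
    [opn_restart] enters it from a with a tail, which makes it a non-collider section. *)
Lemma opn_in_left C a b x h m :
  opn_in (ant (C :|: [set a; b])) C b x h m ->
  opn_in (ant (C :|: [set b])) C b x h m \/
  opn_in (ant (C :|: [set b])) C b a false false.
Proof.
elim=> {x h m} [h|x y h m xy _ [IH|IH]|x y hx hy h m xy Qx _ [IH|IH]];
  try by [right].
- by left; apply: opn_end.
- by left; apply: opn_line xy IH.
case hhx: (h && hx) Qx => Qx; last first.
  by left; apply: opn_edge xy _ IH; rewrite hhx.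
have [xS|xS] := boolP (x \in ant (C :|: [set b])).
  by left; apply: opn_edge xy _ IH; rewrite hhx.
have xC : x \notin ant C.
  apply: contra xS; apply: ant_sub => c cC.
  by apply: sub_ant; rewrite inE cC.
right; have xa : connect toward x a.
  case/antP: Qx => d; rewrite !inE orbCA => /orP[/eqP-> //|dCb xd].
  by case/negP: xS; apply/antP; exists d; rewrite // !inE.
by apply: opn_restart xC xa _; apply: opn_edge xy _ IH.
Qed.

(** At the first collider section not anterior to C, leave along an anterior path to b. This path
    avoids C, since its nodes stay outside [ant C]. The condition on m ensures that such a section
    has not yet met C. *)
Lemma opn_in_right C b x h m :
  opn_in (ant (C :|: [set b])) C b x h m -> (m -> x \in ant C) ->
  opn_in (ant C) C b x h m.
Proof.
elim=> {x h m} [h|x y h m xy _ IH|x y hx hy h m xy Qx _ IH] mC.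
- exact: opn_end.
- apply: (opn_line xy (IH _)) => /orP[/mC|]; last exact: sub_ant.
  exact: ant_line xy.
have {}IH := IH (@sub_ant C y).
case hhx: (h && hx) Qx => Qx; last by apply: opn_edge xy _ IH; rewrite hhx.
have [xS|xC] := boolP (x \in ant C).
  by apply: opn_edge xy _ IH; rewrite hhx.
have -> : m = false by apply: contraNF xC.
have xb : connect toward x b.
  case/antP: Qx => d; rewrite !inE => /orP[dC xd|/eqP-> //].
  by case/negP: xC; apply/antP; exists d.
move: x xb xC h {xy hhx Qx mC}; apply: toward_ind => [|x z xz IHz] xC h.
  exact: opn_end.
have zC : z \notin ant C by apply: contra xC; apply: ant_step.
have zC' : (z \in C) = false by apply: contraNF zC; apply: sub_ant.
case/orP: xz => xz.
  by apply: (@opn_line _ _ _ x z); rewrite ?zC' //; apply: IHz.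
by apply: (@opn_edge _ _ _ x z false true); rewrite ?andbF ?zC' //; apply: IHz.
Qed.

(* The walk makes a detour from x to C and back: along lines the section itself
   meets C, along arrows x is passed twice in non-collider sections. *)
Lemma opn_detour C b x :
  x \in ant C -> x \notin C ->
  opn_met C b x true true -> opn_met C b x false false ->
  opn_met C b x true false.
Proof.
case/antP=> c cC; move: x.
apply: toward_ind => [|x y xy IH] xC ott off; first by rewrite cC in xC.
have {}xC : (x \in C) = false by apply: negbTE.
case/orP: xy => xy; [have yx := xy; rewrite lnC in yx|have yx := xy; rewrite nlC in yx].
  have ytt : opn_met C b y true true by apply: opn_line yx _; rewrite xC.
  apply: opn_line xy _; case: (boolP (y \in C)) => //= yC; apply: IH => //.
  by apply: opn_line yx _; rewrite xC.
have ytt : opn_met C b y true true by apply: opn_edge yx _ _; rewrite ?xC.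
apply: opn_edge xy _ _ => //; case: (boolP (y \in C)) => //= yC; apply: IH => //.
by apply: opn_edge yx _ _; rewrite ?xC.
Qed.

Lemma opn_in_met C b x h m :
  opn_in (ant C) C b x h m -> (x \in C -> m) -> opn_met C b x h m.
Proof.
elim=> {x h m} [h|x y h m xy _ IH|x y hx hy h m xy Qx _ IH] mC.
- exact: opn_end.
- by apply: opn_line xy (IH _) => ->; rewrite orbT.
have {}IH := IH id.
case hhx: (h && hx) Qx => Qx; last by apply: opn_edge xy _ IH; rewrite hhx.
case: m mC => mC; first by apply: opn_edge xy _ IH; rewrite hhx.
case/andP: hhx => -> ->{h} in xy *.
apply: opn_detour => //; first by apply/negP => /mC.
  by apply: opn_edge xy _ IH.
by apply: opn_edge xy _ IH.
Qed.

Lemma opn_inW (C : {set V}) a b :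
  a \notin C -> opn_in (ant (C :|: [set a; b])) C b a false false ->
  opn_met C b a false false.
Proof.
move=> aC oa; have {}oa : opn_in (ant (C :|: [set b])) C b a false false.
  (* The walk starts at a, so both alternatives are the same statement. *)
  by case: (opn_in_left oa).
by apply: opn_in_met; [apply: opn_in_right|rewrite (negbTE aC)].
Qed.

(** A section entered without an arrowhead is a non-collider however it is left, so it must not have
    met C. *)
Lemma opn_met_dead C b x : ~ opn_met C b x false true.
Proof.
have: forall h m, opn_met C b x h m -> ~~ h -> m -> False; last by move=> o /o; apply.
move=> h m; elim=> {x h m} [//|x y h m _ _ IH|x y hx hy h m _ + _ _] hF mT.
  by apply: IH; rewrite ?mT.
by rewrite (negbTE hF) mT.
Qed.

Definition closed_toward (S : {set V}) :=
  forall x y, toward x y -> y \in S -> x \in S.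

(* An induction principle for [opn_met] that also provides membership in S of
   the nodes visited; a section entered with a tail or meeting C lies in S
   because of its past, any other one because of the continuation. *)
Lemma opn_met_closed (S C : {set V}) b (P : V -> bool -> bool -> Prop) x h m :
  closed_toward S -> {subset C <= S} -> b \in S ->
  (forall h, P b h false) ->
  (forall x y h m, ln x y -> P y h (m || (y \in C)) -> P x h m) ->
  (forall x y hx hy h m, nl hx hy x y -> x \in S -> y \in S ->
     (~~ (h && hx) -> ~~ m) -> P y hy (y \in C) -> P x h m) ->
  opn_met C b x h m -> (~~ h -> x \in S) -> (m -> x \in S) ->
  x \in S /\ P x h m.
Proof.
move=> Scl CS bS Pend Pline Pedge.
elim=> {x h m} [h|x y h m xy _ IH|x y hx hy h m xy Qx _ IH] hS mS.
- by split.
- have Sxy : x \in S -> y \in S by apply: Scl; rewrite /toward lnC xy.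
  have [||yS Py] := IH; first by move=> /hS/Sxy.
    by case/orP => [/mS/Sxy|/CS].
  split; last exact: Pline xy Py.
  by apply: Scl yS; rewrite /toward xy.
have xSy : ~~ hy -> x \in S -> y \in S.
  case: hy xy {IH} => // xy _; apply: Scl.
  by rewrite /toward nlC; case: hx xy {Qx} => [-> |]; rewrite ?orbT ?nlFF.
have ySx : ~~ hx -> y \in S -> x \in S.
  case: hx xy {xSy Qx} => // xy _; apply: Scl.
  by rewrite /toward; case: hy xy {IH} => [-> |]; rewrite ?orbT ?nlFF.
have hxhy : hx || hy by case: hx hy xy {Qx IH xSy ySx} => -[]; rewrite ?nlFF.
have [||yS Py] := IH; last 1 first.
- have xS : x \in S.
    case: h hx Qx ySx hS {xSy xy hxhy} => [] [] Qx ySx hS;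
      first [exact: mS|exact: ySx|exact: hS].
  by split=> //; apply: Pedge xy xS yS _ Py; case: (h && hx) Qx.
(* A tail at y forces an arrowhead at x. The section at x is then either a collider that met C or
   was entered with a tail, and x lies in S in both cases. *)
- move=> hyF; apply: (xSy hyF); rewrite (negbTE hyF) orbF in hxhy.
  by rewrite hxhy andbT in Qx; case: h Qx hS => [/mS|_ ->].
- exact: CS.
Qed.

(** * Inducing walks *)

(** A line continues a collider section; an edge with two arrowheads leads to the next one. *)
Definition sib (S : {set V}) x y :=
  [&& ln x y || nl true true x y, x \in S & y \in S].

(* All inner sections of the walk i, s, ..., t, j are colliders. *)
Definition inducing (S : {set V}) hi hj i j :=
  exists s t, [/\ nl hi true i s, nl true hj t j, s \in S, t \in S
                & connect (sib S) s t].

Lemma sibC S : symmetric (sib S).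
Proof. by move=> x y; rewrite /sib lnC nlC [(x \in S) && _]andbC. Qed.

Lemma inducingC S hi hj i j : inducing S hi hj i j -> inducing S hj hi j i.
Proof.
case=> s [t [is_ tj sS tS st]]; exists t, s; split=> //; rewrite 1?nlC //.
by rewrite (sym_connect_sym (@sibC S)).
Qed.

Lemma opn_inducing (S S' C : {set V}) b hi hj i j h m :
  {subset S <= S'} -> inducing S hi hj i j ->
  (if h && hi then i \in S' else ~~ m) ->
  opn_in S' C b j hj (j \in C) -> opn_in S' C b i h m.
Proof.
move=> SS' [s [t [is_ tj sS tS st]]] Qi oj.
(* Inner sections are colliders, which [opn_in] tests only for membership in S'; hence m' can be
   arbitrary. *)
suff os m' : opn_in S' C b s true m' by apply: opn_edge is_ Qi (os _).
case/connectP: st => p; elim: p s m' {is_ sS} => [|x p IH] s m' /=.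
  by move=> _ <-; apply: opn_edge tj _ oj; apply: SS'.
case/andP=> /and3P[sx sS xS] xp tE; have ox m2 := IH x m2 xp tE.
case/orP: sx => sx; first exact: opn_line sx (ox _).
by apply: opn_edge sx _ (ox _); apply: SS'.
Qed.

(** * From a non-separable pair to an inducing walk *)

Section Missing.
Variables i j : V.
Hypothesis ij : i != j.
Hypothesis lnij : ln i j = false.
Hypothesis nlij : forall hi hj, nl hi hj i j = false.
Hypothesis lnI : forall x, ln x x = false.
Hypothesis nlI : forall hx hy x, nl hx hy x x = false.

Let S := ant [set i; j].
Definition missing_sep := S :\: [set i; j].

Let before x := exists hi s, [/\ nl hi true i s, s \in S & connect (sib S) s x].

(** Every node of S other than i and j lies in [missing_sep], so it can occur only in a collider
    section. Invariant: either the walk is at i, where an inducing walk may start, or it is in a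
    collider section of an inducing walk already begun. The clause [h -> before i] serves the case
    where a section entered at i with an arrowhead continues along a line into C. *)
Lemma opn_missing x h m :
  opn_met missing_sep j x h m -> x \in S ->
  (x = i /\ m = false /\ (h -> before i)) \/ [/\ h, m & before x] ->
  exists hi hj, inducing S hi hj i j.
Proof.
have iS : i \in S by apply: sub_ant; rewrite !inE eqxx.
have jS : j \in S by apply: sub_ant; rewrite !inE eqxx orbT.
have before_sib u y : before u -> sib S u y -> before y.
  move=> [hi [s [is_ sS sx]]] xy; exists hi, s; split=> //.
  exact: connect_trans sx (connect1 xy).
have inC y : y \in S -> y != i -> y != j -> y \in missing_sep.
  by move=> yS yi yj; rewrite in_setD in_set2 negb_or yi yj.
have CS : {subset missing_sep <= S} by move=> y; rewrite inE => /andP[].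
have Scl : closed_toward S by move=> y z; apply: ant_step.
elim=> {x h m} [h|x y h m xy oy IH|x y hx hy h m xy Qx oy IH] xS.
- by case=> [[ji _]|[]//]; move: ij; rewrite ji eqxx.
- have yS : y \in S by apply: ant_line xS.
  case=> [[xi [mF hb]]|[hT mT bx]]; last first.
    apply: IH => //; right; rewrite hT mT; split=> //.
    by apply: before_sib bx _; rewrite /sib xy xS yS.
  subst x m; have yC : y \in missing_sep.
    apply: inC => //; first by apply: contraTneq xy => ->; rewrite lnI.
    by apply: contraTneq xy => ->; rewrite lnij.
  rewrite yC in oy IH; case: h hb oy IH => hb oy IH; last by case: (opn_met_dead oy).
  apply: IH => //; right; split=> //.
  by apply: before_sib (hb isT) _; rewrite /sib xy iS yS.
have yS : y \in S.
  have [] // := opn_met_closed (P := fun _ _ _ => True) Scl CS jS _ _ _ oy.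
    2: exact: CS.
  move=> hyF; apply: Scl xS; rewrite /toward nlC.
  by case: hx hy xy {Qx IH oy} hyF => -[] // xy _;
    [rewrite xy orbT|rewrite nlFF in xy].
have hyT : y \in missing_sep -> hy.
  by move=> yC; rewrite yC in oy; case: hy oy {IH xy} => // /opn_met_dead.
case=> [[xi [mF hb]]|[hT mT bx]].
  subst x; have yC : y \in missing_sep.
    apply: inC => //; last by apply: contraTneq xy => ->; rewrite nlij.
    by apply: contraTneq xy => ->; rewrite nlI.
  move/(_ yC): hyT => hyT; rewrite hyT in xy IH.
  apply: IH => //; right; split=> //.
  by exists hx, y.
rewrite hT mT /= in Qx; case: hx Qx xy => // _ xy.
have [yj|yj] := eqVneq y j.
  case: bx => hi [s [is_ sS sx]]; subst y; exists hi, hy.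
  by exists s, x.
(* Back at i, outside C, a new section begins and the first alternative holds again. *)
have [yi|yi] := eqVneq y i.
  subst y; apply: IH => //; left; split=> //; split.
    by rewrite !inE eqxx.
  move=> hyT'; apply: before_sib bx _.
  by rewrite hyT' in xy; rewrite /sib xy orbT xS iS.
have yC := inC y yS yi yj; move/(_ yC): hyT => hyT.
apply: IH => //; right; split=> //.
by apply: before_sib bx _; rewrite hyT in xy; rewrite /sib xy orbT xS yS.
Qed.

End Missing.
End Separation.

(** * Acyclicity, and replacing the new edge by an inducing walk *)

Section Acyclic.
Variables (V : finType) (ln : rel V) (nl : bool -> bool -> rel V).
Hypothesis lnC : symmetric ln.
Hypothesis nlC : forall hx hy x y, nl hx hy x y = nl hy hx y x.
Hypothesis acyclic :
  forall x y, nl false true x y -> ~~ connect (toward ln nl) y x.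

(** The first inner node s is anterior to i or j; a path from s to i would close a cycle with the
    arrow from i to s. *)
Lemma inducing_tail hj i j :
  inducing ln nl (ant ln nl [set i; j]) false hj i j ->
  connect (toward ln nl) i j.
Proof.
case=> s [t [is_ _ /antP[d dij sd] _ _]].
have: connect (toward ln nl) i s by apply: connect1; rewrite /toward is_ orbT.
move/connect_trans; apply; move: dij; rewrite !inE => /orP[]/eqP dE; rewrite dE // in sd.
by case/negP: (acyclic is_).
Qed.

(** By symmetry j is anterior to i, so s is anterior to i whichever endpoint it leads to, against
    acyclicity. *)
Lemma inducing_tails i j :
  ~ inducing ln nl (ant ln nl [set i; j]) false false i j.
Proof.
move=> ind; have [s [t [is_ _ /antP[d dij sd] _ _]]] := ind.
case/negP: (acyclic is_); apply: connect_trans sd _.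
move: dij; rewrite !inE => /orP[]/eqP-> //.
by apply: (@inducing_tail false); rewrite setUC; apply: inducingC.
Qed.

End Acyclic.

(** All nodes of the walk lie in the anterior set S of C, a and b. Where the new edge is used, i and
    j are in S, hence so is [ant {i, j}], and the inducing walk fits in with its colliders in S. *)
Lemma opn_add (V : finType) (ln : rel V) (nl nl' : bool -> bool -> rel V)
    (hi hj : bool) (i j a b : V) (C : {set V}) :
  symmetric ln ->
  (forall hx hy x y, nl hx hy x y = nl hy hx y x) ->
  (forall x y, nl false false x y = false) ->
  (forall hx hy x y, nl' hx hy x y = nl' hy hx y x) ->
  (forall x y, nl' false false x y = false) ->
  (forall hx hy x y, nl' hx hy x y ->
     [\/ nl hx hy x y, [/\ hx = hi, hy = hj, x = i & y = j]
       | [/\ hx = hj, hy = hi, x = j & y = i]]) ->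
  (~~ hi -> connect (toward ln nl) i j) ->
  (~~ hj -> connect (toward ln nl) j i) ->
  inducing ln nl (ant ln nl [set i; j]) hi hj i j ->
  a \notin C -> opn_met ln nl' C b a false false ->
  opn_met ln nl C b a false false.
Proof.
move=> lnC nlC nlFF nlC' nlFF' new hiF hjF ind aC oa.
apply: opn_inW => //; set S := ant _ _ _.
have SD d : d \in C :|: [set a; b] -> d \in S by apply: sub_ant.
have aS : a \in S by apply: SD; rewrite !inE eqxx orbT.
have bS : b \in S by apply: SD; rewrite !inE eqxx !orbT.
have CS : {subset C <= S} by move=> c cC; apply: SD; rewrite inE cC.
(* The new edge enlarges no anterior set: where it has a tail, that endpoint was already anterior to
   the other one. *)
have Scl : closed_toward ln nl' S.
  move=> x y /orP[xy|/new[xy|[hiE _ -> ->]|[hjE _ -> ->]]].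
  - by apply: ant_step; rewrite /toward xy.
  - by apply: ant_step; rewrite /toward xy orbT.
  - by apply: ant_connect; apply: hiF; rewrite -hiE.
  - by apply: ant_connect; apply: hjF; rewrite -hjE.
have [] // := opn_met_closed lnC nlC' nlFF' (P := opn_in ln nl S C b)
  Scl CS bS _ _ _ oa.
- by move=> h; apply: opn_end.
- by move=> x y h m; apply: opn_line.
move=> x y hx hy h m xy xS yS Qx oy.
have {}Qx : if h && hx then x \in S else ~~ m by case: (h && hx) Qx => // ->.
have sub_ij : i \in S -> j \in S -> {subset ant ln nl [set i; j] <= S}.
  by move=> iS jS; apply: ant_sub => d; rewrite in_set2 => /orP[]/eqP->.
case: (new _ _ _ _ xy) => [xy'|[hE hE' xE yE]|[hE hE' xE yE]].
- exact: opn_edge xy' Qx oy.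
- by subst; apply: (opn_inducing _ ind Qx oy); apply: sub_ij.
- subst; apply: (opn_inducing _ (inducingC lnC nlC ind) Qx oy).
  exact: sub_ij.
Qed.

Lemma opn_mono (V : finType) (ln ln' : rel V) (nl nl' : bool -> bool -> rel V)
    (C : {set V}) b x h m :
  subrel ln ln' -> (forall hx hy, subrel (nl hx hy) (nl' hx hy)) ->
  opn_met ln nl C b x h m -> opn_met ln' nl' C b x h m.
Proof.
move=> lnS nlS; elim=> {x h m} [h|x y h m /lnS xy _ IH|x y hx hy h m /nlS xy Qx _ IH].
- exact: opn_end.
- exact: opn_line xy IH.
- exact: opn_edge xy Qx IH.
Qed.

(** * From walks in a graph to abstract walks *)

Section GraphWalks.
Variables (V E : finType) (G : mgraph V E).
Hypothesis noD : forall e, ~~ is_dotted (kind G e).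

Definition line_adj x y := [exists e, is_line (kind G e) && joins G e x y].

Definition head_adj hx hy x y :=
  [exists e, [&& ~~ is_line (kind G e), joins G e x y,
    arrowhead_at G e x == hx & arrowhead_at G e y == hy]].

Lemma joinsC e x y : joins G e x y = joins G e y x.
Proof. by rewrite /joins orbC. Qed.

Lemma joinsxx e x : joins G e x x = false.
Proof.
by apply/negP => /orP[] /andP[/eqP sx /eqP tx]; move: (loopless G e);
  rewrite sx tx eqxx.
Qed.

Lemma line_adjC : symmetric line_adj.
Proof. by move=> x y; apply: eq_existsb => e; rewrite joinsC. Qed.

Lemma head_adjC hx hy x y : head_adj hx hy x y = head_adj hy hx y x.
Proof.
by apply: eq_existsb => e; rewrite joinsC [X in _ && (_ && X)]andbC.
Qed.

Lemma line_adjxx x : line_adj x x = false.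
Proof. by apply/existsP => -[e]; rewrite joinsxx andbF. Qed.

Lemma head_adjxx hx hy x : head_adj hx hy x x = false.
Proof. by apply/existsP => -[e]; rewrite joinsxx andbF. Qed.

Lemma head_adjFF x y : head_adj false false x y = false.
Proof.
apply/existsP => -[e /and4P[nl /orP xy]]; rewrite !eqbF_neg /arrowhead_at.
move: (noD e) nl; case: (kind G e) => // _ _.
  by case: xy => /andP[_ ->].
by case: xy => /andP[-> ].
Qed.

Lemma nonadjacent_line x y : ~~ adjacent G x y -> line_adj x y = false.
Proof.
move=> xy; apply: contraNF xy => /existsP[e /andP[_ exy]].
by apply/existsP; exists e.
Qed.

Lemma nonadjacent_head hx hy x y :
  ~~ adjacent G x y -> head_adj hx hy x y = false.
Proof.
move=> xy; apply: contraNF xy => /existsP[e /and4P[_ exy _ _]].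
by apply/existsP; exists e.
Qed.

(** A one-pass form of [connecting] with the state of [opn]: each section is judged when it is left,
    and the last one as a non-collider. *)
Fixpoint conn (C : {set V}) h m x (w : seq (E * V)) :=
  if w is (e, y) :: w' then
    if is_line (kind G e) then conn C h (m || (y \in C)) y w'
    else (if h && arrowhead_at G e x then m else ~~ m) &&
         conn C (arrowhead_at G e y) (y \in C) y w'
  else ~~ m.

Lemma conn_opn C h m x w :
  is_walk G x w -> conn C h m x w ->
  opn_met line_adj head_adj C (walk_end x w) x h m.
Proof.
elim: w h m x => [|[e y] w IH] h m x /=.
  by case: m => // _ _; apply: opn_end.
case/andP=> exy wy; have [le|nle] := boolP (is_line _).
  move/(IH _ _ _ wy); apply: opn_line.
  by apply/existsP; exists e; rewrite le.
case/andP=> Qx /(IH _ _ _ wy); apply: opn_edge Qx.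
by apply/existsP; exists e; rewrite nle exy !eqxx.
Qed.

Lemma opn_conn C b h m x :
  opn_met line_adj head_adj C b x h m ->
  exists w, [/\ is_walk G x w, walk_end x w = b & conn C h m x w].
Proof.
elim=> {x h m} [h|x y h m xy _ [w [wy wb cw]]|x y hx hy h m xy Qx _ [w [wy wb cw]]].
- by exists [::].
- case/existsP: xy => e /andP[le exy]; exists ((e, y) :: w).
  by split; rewrite //= ?exy // le.
case/existsP: xy => e /and4P[nle exy /eqP hxE /eqP hyE]; exists ((e, y) :: w).
by split; rewrite //= ?exy // (negbTE nle) hxE hyE Qx.
Qed.

(** The value for empty p is false because the first section is an endpoint section, hence a
    non-collider. *)
Definition head_before i (p : seq (E * V)) :=
  if edge_before p is Some e then arrowhead_at G e (walk_end i p) else false.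

Lemma edge_before_rcons (p : seq (E * V)) u : edge_before (rcons p u) = Some u.1.
Proof. by rewrite /edge_before /unzip1 map_rcons rev_rcons. Qed.

Lemma walk_end_cat i (p s : seq (E * V)) :
  walk_end i (p ++ s) = walk_end (walk_end i p) s.
Proof. by rewrite /walk_end /unzip2 map_cat last_cat. Qed.

Lemma walk_end_rcons i (p : seq (E * V)) u : walk_end i (rcons p u) = u.2.
Proof. by rewrite /walk_end /unzip2 map_rcons last_rcons. Qed.

Lemma collider_sectionE i p s q :
  collider_section G i p s q =
  (if q is (f, _) :: _ then
     head_before i p && arrowhead_at G f (walk_end i (p ++ s))
   else false).
Proof.
rewrite /collider_section /head_before walk_end_cat.
case: q => [|[f y] q] /=; first by case: (edge_before p).
rewrite /edge_after /=; case: (edge_before p) => // e.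
by rewrite (negbTE (noD e)) (negbTE (noD f)) andbF /= !orbF.
Qed.

Definition met (C : {set V}) i p (s : seq (E * V)) :=
  has (mem C) (section_nodes i p s).

Lemma met_rcons C i p s u : met C i p (rcons s u) = met C i p s || (u.2 \in C).
Proof.
rewrite /met /section_nodes /unzip2 map_rcons /= has_rcons -orbA.
by congr (_ || _); apply: orbC.
Qed.

Lemma section_ok (C : {set V}) i p s q :
  (if collider_section G i p s q
   then exists2 x, x \in section_nodes i p s & x \in C
   else forall x, x \in section_nodes i p s -> x \notin C) <->
  (if collider_section G i p s q then met C i p s else ~~ met C i p s).
Proof.
case: collider_section; split; first by move=> sC; apply/hasP.
- by move/hasP.
- by move=> sC; apply/hasPn.
- by move/hasPn.
Qed.

(** The part already read is split into p, made of finished sections and the edges after them, and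
    the portion s of the current section. *)
Lemma connecting_conn (C : {set V}) i p s w :
  all_lines G s -> not_line G (edge_before p) ->
  connecting G C i (p ++ s ++ w) ->
  conn C (head_before i p) (met C i p s) (walk_end i (p ++ s)) w.
Proof.
elim: w p s => [|[e y] w IH] p s ls np cw /=.
  have sec : is_section G p s [::] by rewrite /is_section ls np.
  by have /section_ok := cw p s [::] erefl sec; rewrite collider_sectionE.
have [le|nle] := boolP (is_line _).
  have := IH p (rcons s (e, y)); rewrite met_rcons -rcons_cat walk_end_rcons.
  by apply=> //; rewrite ?cat_rcons // /all_lines all_rcons /= le.
have sec : is_section G p s ((e, y) :: w) by rewrite /is_section ls np /= nle.
have /section_ok := cw p s _ erefl sec; rewrite collider_sectionE => -> /=.
have := IH (rcons (p ++ s) (e, y)) [::].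
rewrite /met /head_before /section_nodes cats0 walk_end_rcons edge_before_rcons /=.
by rewrite orbF; apply=> //; rewrite cat_rcons -catA.
Qed.

Lemma cat_lines_inj s w s' w' :
  all_lines G s -> all_lines G s' -> not_line G (edge_after w) ->
  not_line G (edge_after w') -> s ++ w = s' ++ w' -> s = s' /\ w = w'.
Proof.
elim: s s' => [|u s IH] [|u' s'] //=.
- by move=> _ /andP[lu _] + _ wE; rewrite wE /= lu.
- by move=> /andP[lu _] _ _ + wE; rewrite -wE /= lu.
move=> /andP[_ ls] /andP[_ ls'] nw nw' [-> sE].
by have [-> ->] := IH _ ls ls' nw nw' sE.
Qed.

(** If p' were longer than p, its last edge would be a line of s, but no section is preceded by a
    line. *)
Lemma section_inj p s w p' s' w' :
  is_section G p s w -> is_section G p' s' w' ->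
  p ++ s ++ w = p' ++ s' ++ w' -> size p <= size p' <= size p + size s ->
  [/\ p = p', s = s' & w = w'].
Proof.
move=> /and3P[ls np nw] /and3P[ls' np' nw'] wE /andP[pp' p's].
have pE : take (size p) p' = p.
  by move: (congr1 (take (size p)) wE); rewrite take_size_cat // takel_cat.
move: wE np' p's; rewrite -(cat_take_drop (size p) p') pE size_cat leq_add2l -catA.
set t := drop _ _ => /eqP; rewrite eqseq_cat // eqxx /= => /eqP sE np' ts.
have tE : take (size t) s = t.
  by move: (congr1 (take (size t)) sE); rewrite takel_cat // take_size_cat // => ->.
have lt : all_lines G t.
  by move: ls; rewrite -(cat_take_drop (size t) s) tE /all_lines all_cat => /andP[].
case/lastP: t lt np' sE {ts tE} => [|t u] lt np' sE.
  by rewrite cats0; have [-> ->] := cat_lines_inj ls ls' nw nw' sE.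
move: lt np'; rewrite /all_lines all_rcons -rcons_cat edge_before_rcons /=.
by case/andP=> ->.
Qed.

Lemma conn_connecting (C : {set V}) i p s w :
  all_lines G s -> not_line G (edge_before p) ->
  conn C (head_before i p) (met C i p s) (walk_end i (p ++ s)) w ->
  forall p' s' q', p ++ s ++ w = p' ++ s' ++ q' -> is_section G p' s' q' ->
    size p <= size p' ->
  if collider_section G i p' s' q'
  then exists2 x, x \in section_nodes i p' s' & x \in C
  else forall x, x \in section_nodes i p' s' -> x \notin C.
Proof.
elim: w p s => [|[e y] w IH] p s ls np cw p' s' q' wE sec' pp'.
  have sec : is_section G p s [::] by rewrite /is_section ls np.
  have [|<- <- <-] := section_inj sec sec' wE.
    by rewrite pp' -size_cat -[p ++ s]cats0 -catA wE size_cat leq_addr.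
  by apply/section_ok; rewrite collider_sectionE.
move: cw => /=; have [le|nle] := boolP (is_line _) => cw.
  apply: (IH p (rcons s (e, y))) => //; last by rewrite cat_rcons.
    by rewrite /all_lines all_rcons /= le.
  by rewrite met_rcons -rcons_cat walk_end_rcons.
have sec : is_section G p s ((e, y) :: w) by rewrite /is_section ls np /= nle.
(* A section starting no later than the end of s is the current one; later ones are left to the
   induction. *)
case/andP: cw => Qx cw; have [p's|p's] := leqP (size p') (size p + size s).
  have [|<- <- <-] := section_inj sec sec' wE; first by rewrite pp'.
  by apply/section_ok; rewrite collider_sectionE.
apply: (IH (rcons (p ++ s) (e, y)) [::]) => //.
- by rewrite edge_before_rcons.
- by rewrite cats0 /met /head_before /section_nodes edge_before_rcons
       walk_end_rcons /= orbF.
- by rewrite cat_rcons -catA.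
- by rewrite size_rcons size_cat.
Qed.

Lemma connectingP (C : {set V}) i w : connecting G C i w <-> conn C false (i \in C) i w.
Proof.
have -> : (i \in C) = met C i [::] [::] by rewrite /met /= orbF.
split; first by move=> cw; apply: (@connecting_conn C i [::] [::] w).
by move=> cw p s q wE sec; apply: (@conn_connecting C i [::] [::] w).
Qed.

Lemma separatedP (A B C : {set V}) :
  separated G A B C <-> (forall a b, a \in A -> b \in B ->
     ~ opn_met line_adj head_adj C b a false (a \in C)).
Proof.
split=> [sep a b aA bB /opn_conn[w [aw wb cw]]|sep a w aA bB aw /connectingP cw].
  by apply: (sep a w) => //; [rewrite wb|apply/connectingP].
by apply: (sep a _ aA bB); apply: conn_opn.
Qed.

Lemma toward_walk x p :
  path (toward line_adj head_adj) x p ->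
  exists w, [/\ is_walk G x w, unzip2 w = p,
    all (fun u => ~~ is_arc (kind G u.1)) w
    & all (fun u => is_arrow (kind G u.1) ==> (tgt G u.1 == u.2)) w].
Proof.
elim: p x => [|y p IH] x /=; first by exists [::].
case/andP=> xy /IH[w [yw <- wa wt]].
suff [e [exy ea et]] : exists e, [/\ joins G e x y, ~~ is_arc (kind G e)
    & is_arrow (kind G e) ==> (tgt G e == y)].
  by exists ((e, y) :: w); rewrite /= exy ea et.
case/orP: xy => /existsP[e].
  by case/andP=> le exy; exists e; rewrite exy; case: (kind G e) le.
case/and4P=> nle exy xF yT; exists e; move: xF yT nle (noD e).
rewrite exy /arrowhead_at; case: (kind G e) => //=; first by move=> _ /eqP->.
by case/orP: exy => /andP[-> ->]; rewrite ?orbT.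
Qed.

(** A path from y back to x, shortened to have distinct nodes, closes with the arrow from x to y to
    a semi-directed cycle. *)
Lemma CMG_acyclic x y :
  is_CMG G -> head_adj false true x y -> ~~ connect (toward line_adj head_adj) y x.
Proof.
case=> _ acyc xy; apply/negP => /connectP[p yp xE].
have ynx : x != y by apply: contraTneq xy => ->; rewrite head_adjxx.
case/shortenP: yp xE => p' yp' up' _ xE.
have [w [yw wp wa wt]] := toward_walk yp'.
case/existsP: xy => e /and4P[nle exy xF yT].
have ae : is_arrow (kind G e) && (tgt G e == y).
  move: xF yT nle (noD e); rewrite /arrowhead_at; case: (kind G e) => //.
    by move=> _ /eqP->.
  by case/orP: exy => /andP[-> ->]; rewrite ?orbT.
have cyc : is_cycle G x ((e, y) :: w).
  rewrite /is_cycle /= exy yw /walk_end /= wp -xE eqxx.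
  move: up' => /= ->; rewrite andbT.
  by case: w wp {yw wa wt} => // wp; rewrite -wp in xE; rewrite xE eqxx in ynx.
case/andP: ae => ae te; apply: (negP (acyc _ _ cyc)).
by rewrite /semi_directed /= ae wa wt te; case: (kind G e) ae.
Qed.

End GraphWalks.

(** * Adding an edge to a graph *)

Section AddEdge.
Variables (V E : finType) (G : mgraph V E) (k : edge_kind) (i j : V).
Hypothesis ij : i != j.
Let H := add_edge G k ij.

Lemma section_nodes_sub (p s q : seq (option E * V)) x y :
  y \in section_nodes x p s -> y \in x :: unzip2 (p ++ s ++ q).
Proof.
rewrite /section_nodes /unzip2 !map_cat -!cat_cons !mem_cat inE.
by case/orP=> [/eqP->|->]; rewrite ?orbT // /walk_end mem_last.
Qed.

Lemma add_edge_connected (C : {set V}) :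
  C \subset ~: [set i; j] -> ~ separated H [set i] [set j] C.
Proof.
move=> /subsetP CN sep.
have notC x : x \in [:: i; j] -> x \notin C.
  by rewrite !inE => xij; apply/negP => /CN; rewrite !inE xij.
apply: (sep i [:: (None, j)]); rewrite ?inE /walk_end //=.
  by rewrite /joins /= !eqxx.
move=> p s q wE _.
(* A walk with a single edge has only endpoint sections. *)
have -> : collider_section H i p s q = false.
  case: p wE => [|u [|v p]] //= [_]; rewrite /collider_section.
  by case: s q => [|? ?] [|? ?] // _; case: edge_before.
move=> x xs; apply: notC.
have : x \in i :: unzip2 [:: (None : option E, j)] by rewrite wE section_nodes_sub.
by [].
Qed.

Hypothesis noD : forall e, ~~ is_dotted (kind G e).
Hypothesis kh : is_arc k || is_arrow k.

Lemma add_edge_not_dotted e : ~~ is_dotted (kind H e).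
Proof. by case: e => [e|] /=; [apply: noD|case: k kh]. Qed.

Lemma line_adj_add : line_adj H =2 line_adj G.
Proof.
move=> x y; apply/existsP/existsP => [[[e|]]|[e]] /=.
- by exists e.
- by case: k kh.
- by exists (Some e).
Qed.

Lemma head_adj_sub hx hy : subrel (head_adj G hx hy) (head_adj H hx hy).
Proof. by move=> x y /existsP[e xy]; apply/existsP; exists (Some e). Qed.

Lemma head_adj_add hx hy x y : head_adj H hx hy x y ->
  [\/ head_adj G hx hy x y, [/\ hx = is_arc k, hy = true, x = i & y = j]
       | [/\ hx = true, hy = is_arc k, x = j & y = i]].
Proof.
case/existsP => -[e xy|]; first by constructor 1; apply/existsP; exists e.
rewrite /joins /arrowhead_at /=.
case/and4P=> _ /orP[]/andP[/eqP xE /eqP yE] /eqP<- /eqP<-; subst x y;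
  [constructor 2|constructor 3]; case: k kh => // _;
  by rewrite ?eqxx ?orbT // eq_sym (negbTE ij).
Qed.

Lemma same_model_add :
  is_CMG G ->
  inducing (line_adj G) (head_adj G)
    (ant (line_adj G) (head_adj G) [set i; j]) (is_arc k) true i j ->
  same_model G H.
Proof.
move=> cmg ind A B C.
suff sepE : [disjoint A & C] -> separated G A B C <-> separated H A B C.
  by split=> -[AB AC BC] sep; split=> //; apply/sepE.
move=> AC; have AC' a : a \in A -> (a \in C) = false by apply: disjointFr.
have noDH := add_edge_not_dotted.
split=> sep; apply/separatedP => // a b aA bB; rewrite AC' // => oa.
  have /(separatedP noD)/(_ a b aA bB) := sep; rewrite AC' //; apply.
  have {}oa : opn_met (line_adj G) (head_adj H) C b a false false.
    by apply: opn_mono oa => [x y|hx hy x y //]; rewrite line_adj_add.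
  apply: (opn_add _ _ _ _ _ head_adj_add _ _ ind) oa; rewrite ?AC' //.
  - exact: line_adjC.
  - exact: head_adjC.
  - exact: head_adjFF.
  - exact: head_adjC.
  - exact: head_adjFF.
  (* An arrow has its tail at i, and then the inducing walk makes i anterior to j. *)
  case: (is_arc k) ind => // ind _; apply: inducing_tail ind.
  by move=> x y; apply: CMG_acyclic.
have /(separatedP noDH)/(_ a b aA bB) := sep; rewrite AC' //; apply.
by apply: opn_mono oa => [x y|]; [rewrite line_adj_add|apply: head_adj_sub].
Qed.

End AddEdge.

Theorem corollary2 (V E : finType) (G : mgraph V E) (hG : is_CMG G) :
  maximal G <->
  (forall i j : V, i != j -> ~~ adjacent G i j ->
     exists C : {set V},
       C \subset ~: [set i; j] /\ indep_model G [set i] [set j] C).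
Proof.
have [noD _] := hG.
split=> [maxG i j ij nij|sepG k i j ij nij sameG]; last first.
  have [C [CN /sameG[_ _ _ sep]]] := sepG i j ij nij.
  exact: add_edge_connected CN sep.
pose C := missing_sep (line_adj G) (head_adj G) i j.
have CN : C \subset ~: [set i; j] by apply/subsetP => x; rewrite in_setD in_setC => /andP[].
have iC : i \notin C by rewrite in_setD !inE eqxx.
have jC : j \notin C by rewrite in_setD !inE eqxx orbT.
exists C; split=> //; split; rewrite ?disjoints1 ?in_set1 //.
apply/(separatedP noD) => _ _ /set1P-> /set1P->; rewrite (negbTE iC) => oi.
have [hi [hj ind]] : exists hi hj, inducing (line_adj G) (head_adj G)
    (ant (line_adj G) (head_adj G) [set i; j]) hi hj i j.
  apply: opn_missing oi _ _ => //.
  - exact: line_adjC.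
  - exact: head_adjC.
  - exact: head_adjFF.
  - exact: nonadjacent_line.
  - by move=> hi hj; apply: nonadjacent_head.
  - exact: line_adjxx.
  - exact: head_adjxx.
  - by apply: sub_ant; rewrite !inE eqxx.
  - by left.
have acyc x y := CMG_acyclic noD (x := x) (y := y) hG.
have nlC := head_adjC G; have lnC := line_adjC G.
(* The added edge copies the outer arrowheads: an arc for two, an arrow towards the single one; the
   case of none is excluded by acyclicity. *)
case: hi hj ind => -[] ind.
- by apply: (maxG Arc i j ij nij); apply: same_model_add.
- have ji : j != i by rewrite eq_sym.
  have nji : ~~ adjacent G j i.
    by apply: contra nij => /existsP[e]; rewrite joinsC => eij; apply/existsP; exists e.
  apply: (maxG Arrow j i ji nji); apply: same_model_add => //=.
  by rewrite setUC; apply: inducingC.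
- by apply: (maxG Arrow i j ij nij); apply: same_model_add.
- exact: inducing_tails ind.
Qed.
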